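(* Let $R$ be a commutative ring and let $P(x,y)=0$ be an isolating Z-Mahler equation over $R$, i.e. $P(x,y)=y-\sum_{i=1}^{d}A_i(x)\Phi^i(y)$ with $A_i(x)\in R[x]$, where $\Phi$ is the Z-Mahler operator. If $f=\sum_{n\geq 0}f_nx^n\in R[[x]]$ is a solution of $P(x,f(x))=0$, then there is a weighted automaton $\mathcal{A}$ with input alphabet $\{0,1\}$ and weights in $R$ which generates $f$ in the Zeckendorf numeration, i.e. $f_n=\mathrm{weight}_{\mathcal{A}}((n)_Z)$ for all $n\geq 0$.
   Context: Zeckendorf numeration: let $F_{-2}=0$, $F_{-1}=1$, $F_n=F_{n-1}+F_{n-2}$ for $n\geq 0$ (so $F_0=1,F_1=2,F_2=3,\ldots$). Every $n\in\mathbb{N}=\{0,1,2,\dots\}$ has a unique expansion $n=\sum_{i=0}^k b_iF_i$ with $b_i\in\{0,1\}$ and no two consecutive digits equal to $1$ (up to leading zeros); $(n)_Z=b_k\cdots b_0$ denotes this canonical expansion without leading zeros, read from the most significant digit. Define $\phi:\mathbb{N}\to\mathbb{N}$ by $\phi(\sum_i b_iF_i)=\sum_i b_iF_{i+1}$ where $(n)_Z=b_k\cdots b_0$. Z-Mahler operator: $\Phi:R[[x]]\to R[[x]]$, $\Phi(\sum_{n\ge0} f_nx^n)=\sum_{n\ge0} f_nx^{\phi(n)}$; $\Phi^i$ is its $i$-th iterate. A Z-Mahler equation is an equation $\sum_{i=0}^dA_i(x)\Phi^i(y)=0$ with $A_i\in R[x]$; it is isolating if $A_0=1$ (the remaining terms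 are then written with a minus sign as in the claim). Weighted automaton: a tuple $(S,B,\Delta,I,F)$ with $S$ a finite set of states, $B$ an alphabet, $I,F:S\to R$ (initial and final weights) and $\Delta:S\times B\times S\to R$ (transition weights). A path $s_0\to s_1\to\cdots\to s_n$ with label $b_1\cdots b_n$ and transition weights $r_i=\Delta(s_{i-1},b_i,s_i)$ has weight $I(s_0)r_1\cdots r_nF(s_n)$. The weight $\mathrm{weight}_{\mathcal{A}}(w)$ of a word $w\in B^*$ is the sum of the weights of all paths with label $w$. *)

(* Defs.v *)
From HB Require Import structures.
From mathcomp Require Import all_boot all_order all_algebra.
From mathcomp Require Import zify.

Set Implicit Arguments.
Unset Strict Implicit.
Unset Printing Implicit Defensive.

Import GRing.Theory.
Local Open Scope ring_scope.

Section Zeckendorf.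
Local Open Scope nat_scope.

(* Starts at F_0 = 1, F_1 = 2: zfib n is the usual Fibonacci number of index
   n + 2. *)
Fixpoint zfib (n : nat) : nat :=
  if n is n1.+1 then if n1 is n2.+1 then zfib n1 + zfib n2 else 2 else 1.
Arguments zfib : simpl never.

(* Words over {0,1} are boolean sequences (true is the digit 1) read from the
   most significant digit, so the digit b_i of w is nth false (rev w) i.
   The sum of the b_i F_(i + k): k = 0 gives the value of w, k = 1 the value
   after shifting every F_i to F_(i + 1). *)
Definition zval (k : nat) (w : seq bool) : nat :=
  \sum_(i < size w) nth false (rev w) i * zfib (i + k).

Definition no11 (w : seq bool) : bool := sorted (fun b c => ~~ (b && c)) w.

(* The empty word, which is the expansion of 0, is canonical. *)
Definition zcanonical (w : seq bool) : bool := head true w && no11 w.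

Fixpoint zgreedy (k n : nat) : seq bool :=
  if k is k'.+1 then
    if zfib k' <= n then true :: zgreedy k' (n - zfib k')
    else false :: zgreedy k' n
  else [::].

(* (n)_Z; starting the greedy algorithm at F_(n-1) is enough since n < F_n.
   Lemmas zeck_canonical, zeckK and zeck_unique characterize it. *)
Definition zeck (n : nat) : seq bool :=
  let w := zgreedy n n in drop (index true w) w.

Definition zphi (n : nat) : nat := zval 1 (zeck n).

Lemma zfibSS n : zfib n.+2 = zfib n.+1 + zfib n. Proof. by []. Qed.

Lemma zfib_gt n : n < zfib n.
Proof.
suff: (n < zfib n) && (n.+1 < zfib n.+1) by case/andP.
by elim: n => [//|n /andP[h1 h2]]; rewrite zfibSS h2 andTb; lia.
Qed.

Lemma zfib_leS n : zfib n <= zfib n.+1.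
Proof. by case: n => [//|n]; rewrite zfibSS leq_addr. Qed.

Lemma zval_nil k : zval k [::] = 0. Proof. by rewrite /zval big_ord0. Qed.

Lemma zval_cons k b w : zval k (b :: w) = b * zfib (size w + k) + zval k w.
Proof.
rewrite /zval /= big_ord_recr /= rev_cons nth_rcons size_rev ltnn eqxx addnC.
congr addn; apply: eq_bigr => i _.
by rewrite nth_rcons size_rev ltn_ord.
Qed.

Lemma zval_rcons0 w : zval 0 (rcons w false) = zval 1 w.
Proof.
elim: w => [|b w IH]; first by rewrite zval_cons !zval_nil.
by rewrite rcons_cons !zval_cons IH size_rcons addn0 addn1.
Qed.

Lemma zval_shift w : zval 0 w <= zval 1 w.
Proof.
elim: w => [|b w IH]; first by rewrite !zval_nil.
by rewrite !zval_cons addn0 addn1 leq_add // leq_mul2l zfib_leS orbT.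
Qed.

Lemma no11_cons b w : no11 (b :: w) -> no11 w /\ (b -> head false w = false).
Proof.
rewrite /no11 /=; case: w => [//|c w] /= /andP[h ->]; split => // hb.
by move: h; rewrite hb; case: c.
Qed.

Lemma zval_lt w : no11 w -> zval 0 w < zfib (size w).
Proof.
suff H n u : size u <= n -> no11 u -> zval 0 u < zfib (size u).
  exact: H (leqnn _).
elim: n u => [|n IH] [|b u] //; rewrite ?zval_nil //= ltnS => hs.
move=> /no11_cons[hu hb]; rewrite zval_cons addn0.
have hlt := IH u hs hu.
case: b hb => [/(_ isT)|_]; last first.
  by rewrite mul0n add0n; apply: leq_trans hlt (zfib_leS _).
case: u hs hu hlt => [|c u] hs hu hlt /=; first by rewrite zval_nil.
move=> hc; rewrite hc in hu *.
have [hu' _] := no11_cons hu.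
by rewrite zfibSS mul1n zval_cons mul0n add0n ltn_add2l (IH u (ltnW hs) hu').
Qed.

Lemma zgreedy_size k n : size (zgreedy k n) = k.
Proof. by elim: k n => [//|k IH] n /=; case: ifP; rewrite /= IH. Qed.

Lemma zgreedyK k n : n < zfib k -> zval 0 (zgreedy k n) = n.
Proof.
elim: k n => [|k IH] n /=; first by rewrite zval_nil; case: n.
move=> hn; case: ifP => hk; rewrite zval_cons zgreedy_size addn0.
  have hlt : n - zfib k < zfib k.
    case: k hk hn {IH} => [|k]; first by rewrite /zfib; lia.
    by rewrite zfibSS; have := zfib_leS k; lia.
  by rewrite IH // mul1n subnKC.
by rewrite mul0n add0n IH // ltnNge hk.
Qed.

Lemma zgreedy_no11 k n : n < zfib k -> no11 (zgreedy k n).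
Proof.
elim: k n => [//|k IH] n hn /=.
case: ifP => hk; last first.
  have hn' : n < zfib k by rewrite ltnNge hk.
  have := IH _ hn'; rewrite /no11 /=.
  by case: (zgreedy k n).
case: k hk hn IH => [|k] hk hn IH; first by [].
have hlt : n - zfib k.+1 < zfib k by move: hn; rewrite zfibSS; lia.
have := IH _ (leq_trans hlt (zfib_leS k)).
by rewrite /no11 /= [zfib k <= _]leqNgt hlt /=.
Qed.

Lemma drop_true (w : seq bool) :
  w = nseq (index true w) false ++ drop (index true w) w.
Proof. by elim: w => [//|[] w IH] //=; rewrite -IH. Qed.

Lemma zval_lead0 k j w : zval k (nseq j false ++ w) = zval k w.
Proof. by elim: j => [//|j IH]; rewrite /= zval_cons IH. Qed.

Lemma zeckK n : zval 0 (zeck n) = n.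
Proof.
rewrite /zeck -(zval_lead0 0 (index true (zgreedy n n))) -drop_true.
exact: zgreedyK (zfib_gt n).
Qed.

Lemma zeck_canonical n : zcanonical (zeck n).
Proof.
apply/andP; split; rewrite /zeck.
  by elim: (zgreedy n n) => [|[] w IH].
have := zgreedy_no11 (zfib_gt n).
by elim: (zgreedy n n) => [|[] w IH] // /no11_cons[/IH].
Qed.

Lemma zgreedy_zval w : no11 w -> zgreedy (size w) (zval 0 w) = w.
Proof.
elim: w => [//|b w IH] hw; have [hw' _] := no11_cons hw.
rewrite /= zval_cons addn0; have hlt := zval_lt hw'.
case: b {hw}; first by rewrite mul1n leq_addr addnC addnK IH.
by rewrite mul0n add0n leqNgt hlt /= IH.
Qed.

Lemma zgreedy_lead0 j k n :
  n < zfib k -> zgreedy (j + k) n = nseq j false ++ zgreedy k n.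
Proof.
move=> hn; elim: j => [//|j IH]; rewrite addSn /= IH.
suff -> : zfib (j + k) <= n = false by [].
apply/negbTE; rewrite -ltnNge; apply: leq_trans hn _.
by elim: j {IH} => [//|j IH]; apply: leq_trans IH (zfib_leS _).
Qed.

Lemma zeck_unique w : zcanonical w -> zeck (zval 0 w) = w.
Proof.
case/andP=> hh hw; rewrite /zeck; set n := zval 0 w.
have hs : size w <= n.
  case: w hh hw @n => [//|[] w] //= _ hw; rewrite zval_cons mul1n addn0.
  exact: leq_trans (zfib_gt _) (leq_addr _ _).
rewrite -{1 3}(subnK hs) zgreedy_lead0 ?zval_lt // zgreedy_zval //.
elim: (n - size w) => [|j IH] //=.
by case: w hh {hw n hs} => [//|[] w].
Qed.

Lemma leq_zphi n : n <= zphi n.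
Proof. by rewrite -{1}(zeckK n) zval_shift. Qed.

Lemma zphi_inj : injective zphi.
Proof.
have H n : 0 < n -> zeck (zphi n) = rcons (zeck n) false.
  move=> n0; rewrite /zphi -zval_rcons0; apply: zeck_unique.
  have := zeck_canonical n; have := zeckK n; rewrite /zcanonical.
  case: (zeck n) => [|b w]; first by rewrite zval_nil => e; rewrite -e in n0.
  move=> _ /andP[/= -> ] /=; rewrite /no11 /= rcons_path => ->.
  by rewrite andbF.
have z0 : zphi 0 = 0 by rewrite /zphi /zeck /= zval_nil.
move=> [|m] [|n] // e.
- by have := leq_zphi n.+1; rewrite -e z0.
- by have := leq_zphi m.+1; rewrite e z0.
have := congr1 zeck e; rewrite !H // => /rcons_inj[e'].
by rewrite -(zeckK m.+1) e' zeckK.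
Qed.

End Zeckendorf.

(* A formal power series is its coefficient function nat -> R. *)
Section Mahler.
Variable R : comNzRingType.
Implicit Types (f g : nat -> R) (p : {poly R}).

(* Coefficient m collects the f_n with phi(n) = m; the bound n <= m loses
   nothing because n <= phi(n). *)
Definition zPhi f (m : nat) : R := \sum_(n < m.+1 | zphi n == m) f n.

Definition pseries_mul p f (n : nat) : R := \sum_(i < n.+1) p`_i * f (n - i)%N.

(* Only the values A 1, ..., A d matter. *)
Definition isolating_zmahler (d : nat) (A : nat -> {poly R}) f (n : nat) : R :=
  f n - \sum_(1 <= i < d.+1) pseries_mul (A i) (iter i zPhi f) n.

Lemma zPhi_zphi f n : zPhi f (zphi n) = f n.
Proof.
have hn : (n < (zphi n).+1)%N by rewrite ltnS leq_zphi.
rewrite /zPhi (big_pred1 (Ordinal hn)) //= => i.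
by rewrite /= (inj_eq zphi_inj).
Qed.

Lemma zPhi_out f m : (forall n, zphi n <> m) -> zPhi f m = 0.
Proof. by move=> h; rewrite /zPhi big_pred0 // => i; apply/eqP/h. Qed.

End Mahler.

Record wautomaton (R : comNzRingType) (B : Type) := WAutomaton {
  wstate : finType;
  winit : wstate -> R;
  wtrans : wstate -> B -> wstate -> R;
  wfinal : wstate -> R
}.

(* A path labelled by w visits states s 0, ..., s (size w); lift ord0 i is the
   index i + 1. *)
Definition path_weight (R : comNzRingType) (B : Type) (A : wautomaton R B)
    (w : seq B) (s : {ffun 'I_(size w).+1 -> wstate A}) : R :=
  winit (s ord0)
  * (\prod_(i < size w)
       wtrans (s (widen_ord (leqnSn _) i)) (tnth (in_tuple w) i)
              (s (lift ord0 i)))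
  * wfinal (s ord_max).

Definition weight (R : comNzRingType) (B : Type) (A : wautomaton R B)
    (w : seq B) : R :=
  \sum_(s : {ffun 'I_(size w).+1 -> wstate A}) path_weight s.

Definition zgenerates (R : comNzRingType) (A : wautomaton R bool)
    (f : nat -> R) : Prop :=
  forall n : nat, f n = weight A (zeck n).

(* Main.v *)
Require Import Defs.
From mathcomp Require Import all_boot all_order all_algebra.
From mathcomp Require Import zify.
From Stdlib Require Import ClassicalEpsilon.

Set Implicit Arguments.
Unset Strict Implicit.
Unset Printing Implicit Defensive.

Import GRing.Theory.
Local Open Scope ring_scope.

(* Write m |-> phi(m) + b for the effect on values of appending a digit b.  By the
   equation, f at phi(m) + b + c is a combination of the Phi^i(f), i >= 1, at the points
   phi(m) + b + c - j; each of them vanishes or is Phi^(i-1)(f) at some m + c', where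
   phi(m + c') = phi(m) + b + c - j.  As phi grows by at least 3/2 on average, c' stays
   in the same bounded range as c, so the finitely many functions
   m |-> (Phi^i f)(m + c) satisfy a linear recursion along digits.  Its coefficients
   depend only on the last digits of the expansions of the integers near m: with e(y)
   the last digit of y, phi(y + 1) = phi(y) + 2 - e(y), and e(y) = 0 exactly when y is in
   the image of phi, so this window of the Fibonacci word evolves deterministically.
   The states of the automaton are pairs of a window and an index (i, c). *)

(** * Last digits and the growth of phi *)

Section ShiftMap.
Local Open Scope nat_scope.

Definition zlast (n : nat) : bool := last false (zeck n).

Lemma zval_rcons k w b : zval k (rcons w b) = zval k.+1 w + b * zfib k.
Proof.
elim: w => [|c w IH]; first by rewrite zval_cons !zval_nil addn0.
by rewrite rcons_cons !zval_cons IH size_rcons addSnnS addnA.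
Qed.

Lemma zvalSS k w : zval k.+2 w = zval k.+1 w + zval k w.
Proof.
elim: w => [|c w IH]; first by rewrite !zval_nil.
by rewrite !zval_cons IH !addnS zfibSS mulnDr addnACA.
Qed.

Lemma zphi_canonical w : zcanonical w -> zphi (zval 0 w) = zval 1 w.
Proof. by move=> hw; rewrite /zphi zeck_unique. Qed.

Lemma zcanonical_rconsE w b :
  zcanonical (rcons w b) ->
  [/\ zcanonical w, ~~ (b && last false w) & (w != [::]) || b].
Proof.
rewrite /zcanonical /no11; case: w => [|c w] /=; first by case: b.
by case: c => //=; rewrite rcons_path => /andP[-> ]; rewrite andbC.
Qed.

Lemma zcanonical_rcons w b :
  zcanonical w -> ~~ (b && last false w) -> (w != [::]) || b ->
  zcanonical (rcons w b).
Proof.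
rewrite /zcanonical /no11; case: w => [|c w] /=; first by case: b.
by case: c => //= h hb _; rewrite rcons_path h /= andbC.
Qed.

Lemma zphi0 : zphi 0 = 0.
Proof. by rewrite /zphi /zeck /= zval_nil. Qed.

Lemma zlast0 : zlast 0 = false. Proof. by []. Qed.

(** Unless [z] and [b] are both zero, appending [b] to the expansion of [z] gives the expansion of
    [zphi z + b]; the second formula is then the Fibonacci recurrence. *)
Lemma zphi_zphiD z (b : bool) :
  ~~ (b && zlast z) ->
  zlast (zphi z + b) = b /\ zphi (zphi z + b) = zphi z + z + 2 * b.
Proof.
move=> hb; have [/andP[/eqP-> /negbTE->]|h] := boolP ((z == 0) && ~~ b).
  by rewrite zphi0 zlast0 zphi0.
have hw : zcanonical (rcons (zeck z) b).
  apply: zcanonical_rcons => //; first exact: zeck_canonical.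
  case: b {hb} h => [|]; rewrite ?orbT // andbT orbF; apply: contra => /eqP h.
  by rewrite -(zeckK z) h zval_nil.
have e : zphi z + b = zval 0 (rcons (zeck z) b) by rewrite zval_rcons muln1.
split; rewrite e; first by rewrite /zlast zeck_unique // last_rcons.
by rewrite zphi_canonical // zval_rcons zvalSS zeckK mulnC.
Qed.

Lemma zlast_zphi z : zlast (zphi z) = false.
Proof. by have [] := @zphi_zphiD z false isT; rewrite addn0. Qed.

Lemma zphi_zphi z : zphi (zphi z) = zphi z + z.
Proof. by have [] := @zphi_zphiD z false isT; rewrite !addn0. Qed.

(** The witness is the value of the expansion of [y] with its last digit dropped. *)
Lemma zphiP y : exists2 z, y = zphi z + zlast y & ~~ (zlast y && zlast z).
Proof.
have := zeckK y; have := zeck_canonical y; rewrite /zlast.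
case: (lastP (zeck y)) => [_ <-|w b].
  by exists 0; rewrite ?zphi0 ?zval_nil.
move=> /zcanonical_rconsE[hw hb _] hy; exists (zval 0 w).
  by rewrite zphi_canonical // last_rcons -hy zval_rcons muln1.
by rewrite zeck_unique // last_rcons.
Qed.

Lemma zphi_gt z : 0 < z -> z < zphi z.
Proof.
have [y hy hb] := zphiP z; have [_] := zphi_zphiD hb; rewrite -hy => -> z0.
suff : 0 < y + zlast z by lia.
by case: y (zlast z) hy {hb} => [|y] [] //=; rewrite zphi0; lia.
Qed.

(** Strong induction through the [z] with [y = zphi z + zlast y]: the successor of [y] is
    [zphi z.+1], unless [y] and [z] both end in 0; then it is [zphi z + 1], a digit 1 appended to
    [z]. *)
Lemma zphiS y : zphi y.+1 + zlast y = zphi y + 2.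
Proof.
elim/ltn_ind: y => y IH; case: (posnP y) => [->|y0].
  have [] := @zphi_zphiD 0 true isT.
  by rewrite zphi0 zlast0 add0n => _ ->.
have [z hy hb] := zphiP y; have [_] := zphi_zphiD hb; rewrite -hy => hpy.
have zy : z < y.
  case: (posnP z) => [->//|/zphi_gt]; lia.
have := IH _ zy; case E: (zlast y) (hb) hy hpy => /= => [/negbTE-> |_] hy hpy.
  move=> hz; have e : y.+1 = zphi z.+1 by lia.
  by rewrite e zphi_zphi hpy; lia.
case Ez: (zlast z) => hz.
  have e : y.+1 = zphi z.+1 by lia.
  by rewrite e zphi_zphi hpy; lia.
have [] := @zphi_zphiD z true; first by rewrite Ez.
have {}hy : y = zphi z by rewrite hy addn0.
by rewrite hy zphi_zphi addn1 => _ ->; lia.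
Qed.

Lemma zlastS y : zlast y -> zlast y.+1 = false.
Proof.
move=> hl; have [z hy] := zphiP y; rewrite hl /= => /negbTE hz.
have := zphiS z; rewrite hz => h.
have -> : y.+1 = zphi z.+1 by move: hy; rewrite hl; lia.
exact: zlast_zphi.
Qed.

Lemma zphi_mono : {mono zphi : x y / x <= y}.
Proof.
apply: leq_mono; apply: homo_ltn => [|y]; first exact: ltn_trans.
by have := zphiS y; case: (zlast y) => /=; lia.
Qed.

(** The increments of phi are 1 or 2, and by [zlastS] never 1 twice in a row, so two steps gain at
    least 3; the final [+ 1] absorbs an odd step. *)
Lemma zphi_growth x k : 2 * zphi x + 3 * k <= 2 * zphi (x + k) + 1.
Proof.
elim/ltn_ind: k => -[|[|k]] IH; first by rewrite addn0; lia.
  by rewrite (addn1 x); have := zphiS x; case: (zlast x) => /=; lia.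
have := IH k (ltnW (leqnn _)); have -> : x + k.+2 = (x + k).+2 by rewrite !addnS.
have := zphiS (x + k); have := zphiS (x + k).+1.
case E: (zlast (x + k)); first by rewrite (zlastS E) /nat_of_bool; lia.
by case: (zlast _); rewrite /nat_of_bool; lia.
Qed.

Lemma zlast_imageP y : reflect (exists z, zphi z = y) (~~ zlast y).
Proof.
apply: (iffP idP) => [|[z <-]]; last by rewrite zlast_zphi.
by have [z hy _] := zphiP y => /negbTE h; exists z; rewrite hy h addn0.
Qed.

Lemma zphi_window x x' n :
  (forall i, i < n -> zlast (x + i) = zlast (x' + i)) ->
  forall i, i <= n -> zphi (x + i) + zphi x' = zphi (x' + i) + zphi x.
Proof.
move=> h; elim=> [|i IH] hi; first by rewrite !addn0 addnC.
have := IH (ltnW hi); have := zphiS (x + i); have := zphiS (x' + i).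
by rewrite (h i hi) !addnS; lia.
Qed.

(** A digit is 0 exactly at images of phi; by monotonicity the preimage lies between [x] and
    [x + n], where [zphi_window] transports it. *)
Lemma zlast_window x x' n :
  (forall i, i < n -> zlast (x + i) = zlast (x' + i)) ->
  forall v, zphi x + v <= zphi (x + n) ->
    zlast (zphi x + v) = zlast (zphi x' + v).
Proof.
move=> h v hv; have hw := zphi_window h.
have hv' : zphi x' + v <= zphi (x' + n) by have := hw n (leqnn n); lia.
apply: negb_inj; apply/zlast_imageP/zlast_imageP => -[z hz].
- have xz : x <= z by rewrite -zphi_mono hz leq_addr.
  have zn : z <= x + n by rewrite -zphi_mono hz.
  exists (x' + (z - x)); have := hw (z - x); rewrite subnKC //; lia.
- have xz : x' <= z by rewrite -zphi_mono hz leq_addr.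
  have zn : z <= x' + n by rewrite -zphi_mono hz.
  exists (x + (z - x')); have := hw (z - x'); rewrite subnKC //; lia.
Qed.

(** * Windows of last digits and their evolution *)

Section Window.
Variable C : nat.

(* For m < C part of the window around m would be negative; the first component then
   determines m completely, so that the bits are irrelevant. *)
Definition zwindow (m : nat) : 'I_C.+1 * {ffun 'I_(2 * C).+1 -> bool} :=
  (inord (minn m C), [ffun i : 'I_(2 * C).+1 => zlast (m - C + i)]).

Lemma zwindowP m m' :
  zwindow m = zwindow m' <->
  m = m' \/ [/\ C <= m, C <= m' &
             forall i, i < (2 * C).+1 -> zlast (m - C + i) = zlast (m' - C + i)].
Proof.
split=> [[/(congr1 val)]|[->//|[hm hm' h]]]; last first.
  rewrite /zwindow !(minn_idPr _) //; congr pair.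
  by apply/ffunP => i; rewrite !ffunE h.
rewrite /= !inordK ?ltnS ?geq_minr // => hmin /ffunP hw.
case: (ltnP m C) => hm; first by left; lia.
case: (ltnP m' C) => hm'; first by left; lia.
by right; split=> // i hi; have := hw (Ordinal hi); rewrite !ffunE.
Qed.

Lemma zwindow_step m m' (b : bool) :
  2 < C -> zwindow m = zwindow m' ->
  zwindow (zphi m + b) = zwindow (zphi m' + b).
Proof.
move=> C2 /zwindowP[->//|[hm hm' h]]; apply/zwindowP; right.
have lm := leq_zphi m; have lm' := leq_zphi m'.
have h2 i : i < 2 * C -> zlast (m - C + i) = zlast (m' - C + i).
  by move=> hi; apply: h; lia.
have := zphi_window h2 (leq_pmull C (isT : 0 < 2)); rewrite !subnK // => e.
(* Both gaps are at least (3C - 1)/2, so for C > 2 the window of [zphi m + b] lies between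
   [zphi (m - C)] and [zphi (m + C)]. *)
have := zphi_growth (m - C) C; rewrite subnK // => g1.
have := zphi_growth m C => g2.
split; [by lia | by lia | move=> i hi].
have -> : zphi m + b - C + i = zphi (m - C) + (zphi m - zphi (m - C) + b + i - C).
  by lia.
rewrite (zlast_window h2); first by congr zlast; lia.
have -> : m - C + 2 * C = m + C by lia.
by lia.
Qed.

(* With positions in the window written as m + c - C, [zmove m b c j c'] says that
   position c of the window of phi(m) + b, decreased by j, is the image under phi of
   position c' of the window of m. *)
Definition zmove (m : nat) (b : bool) (c j c' : nat) : bool :=
  (C <= m + c') && (zphi m + b + c == zphi (m + c' - C) + C + j).

Lemma zmove_window m m' b c j c' :
  c' <= 2 * C -> zwindow m = zwindow m' -> zmove m b c j c' = zmove m' b c j c'.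
Proof.
move=> hc /zwindowP[->//|[hm hm' h]]; rewrite /zmove.
have h2 i : i < 2 * C -> zlast (m - C + i) = zlast (m' - C + i).
  by move=> hi; apply: h; lia.
have e := zphi_window h2 (leq_pmull C (isT : 0 < 2)).
have e' := zphi_window h2 hc.
move: e e'; rewrite !subnK // !(addnBAC c') //; lia.
Qed.

(** If [m] and [k] were more than [C] apart, their images would differ by at least (3C + 2)/2, but
    the equation allows at most the larger of C + j and C + 1. *)
Lemma zmove_ex m (b : bool) c j k :
  2 * j + 3 <= C -> c <= 2 * C -> zphi m + b + c = zphi k + C + j ->
  m <= k + C /\ k <= m + C.
Proof.
move=> hj hc e; split.
- case: (leqP m (k + C)) => // h; exfalso.
  have := zphi_growth k (m - k); rewrite subnKC; lia.
- case: (leqP k (m + C)) => // h; exfalso.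
  by have := zphi_growth m (k - m); case: b e; rewrite /nat_of_bool subnKC; lia.
Qed.

End Window.
End ShiftMap.

(** * Weights of automata as iterated vectors *)

Section Automaton.
Variable R : comNzRingType.

Section Forward.
Variables (B : Type) (S : finType) (trans : S -> B -> S -> R) (final : S -> R).

Definition wstep (a : S -> R) (b : B) (s : S) : R := \sum_t a t * trans t b s.

(** Splitting off the first state of each path and summing over it absorbs the first letter into the
    initial weights. *)
Lemma weight_cons a b (w : seq B) :
  weight (WAutomaton a trans final) (b :: w) =
  weight (WAutomaton (wstep a b) trans final) w.
Proof.
pose tl (s : {ffun 'I_(size w).+2 -> S}) : {ffun 'I_(size w).+1 -> S} :=
  [ffun i => s (lift ord0 i)].
pose cs (u : S * {ffun 'I_(size w).+1 -> S}) : {ffun 'I_(size w).+2 -> S} :=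
  [ffun i => if unlift ord0 i is Some j then u.2 j else u.1].
pose uncs (s : {ffun 'I_(size w).+2 -> S}) := (s ord0, tl s).
have csK : cancel uncs cs.
  move=> s; apply/ffunP => i; rewrite ffunE.
  by case: unliftP => [j ->|->] //=; rewrite ffunE.
have csK' : cancel cs uncs.
  move=> [x s]; congr pair; first by rewrite ffunE unlift_none.
  by apply/ffunP => i; rewrite !ffunE liftK.
rewrite /weight (reindex cs) /=; last by exists uncs => ? _; [exact: csK' | exact: csK].
rewrite -(pair_bigA _ (fun x s => path_weight (A := WAutomaton a trans final)
  (w := b :: w) (cs (x, s)))) exchange_big /=.
apply: eq_bigr => s _; rewrite /path_weight /= /wstep !mulr_suml.
apply: eq_bigr => x _; rewrite big_ord_recl /= !mulrA.
have cs0 : cs (x, s) ord0 = x by rewrite ffunE unlift_none.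
have csS i : cs (x, s) (lift ord0 i) = s i by rewrite ffunE liftK.
have -> : widen_ord (leqnSn (size w).+1) ord0 = ord0 by apply: val_inj.
have -> : ord_max = lift ord0 (ord_max : 'I_(size w).+1) by apply: val_inj.
rewrite cs0 !csS; congr (_ * _ * _); apply: eq_bigr => i _.
have -> : widen_ord (leqnSn (size w).+1) (lift ord0 i) =
  lift ord0 (widen_ord (leqnSn (size w)) i) by apply: val_inj.
by rewrite !csS !(tnth_nth b).
Qed.

Lemma weight_foldl a (w : seq B) :
  weight (WAutomaton a trans final) w =
  \sum_s foldl wstep a w s * final s.
Proof.
elim: w a => [|b w IH] a; last by rewrite weight_cons IH.
rewrite /weight /path_weight /=.
rewrite (reindex (fun x => [ffun=> x] : {ffun 'I_1 -> S})) /=; last first.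
  exists (fun s : {ffun 'I_1 -> S} => s ord0) => [x|s] _; first by rewrite ffunE.
  by apply/ffunP => i; rewrite ffunE (ord1 i).
by apply: eq_bigr => x _; rewrite big_ord0 mulr1 !ffunE.
Qed.

End Forward.

(* Appending b to the expansion of m turns it into the expansion of phi(m) + b, so an
   automaton whose states pair the class of m with an index s can carry g s m. *)
Lemma zgenerates_recursion (Q S : finType) (q : nat -> Q) (g : S -> nat -> R)
    (M : nat -> bool -> S -> S -> R) (s0 : S) :
  (forall m m' (b : bool), q m = q m' -> q (zphi m + b)%N = q (zphi m' + b)%N) ->
  (forall m m' b s t, q m = q m' -> M m b s t = M m' b s t) ->
  (forall m (b : bool) s, g s (zphi m + b)%N = \sum_t M m b s t * g t m) ->
  exists Aut : wautomaton R bool, zgenerates Aut (g s0).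
Proof.
move=> hq hM hg.
(* Transitions are read off at a chosen representative of each class; classes outside the image of
   [q] get an arbitrary one and never carry weight. *)
pose rep (x : Q) : nat := epsilon (inhabits 0%N) (fun m => q m = x).
have repK m : q (rep (q m)) = q m.
  by apply: (epsilon_spec (inhabits 0%N) (fun k => q k = q m)); exists m.
pose trans (u : Q * S) (b : bool) (v : Q * S) : R :=
  if v.1 == q (zphi (rep u.1) + b)%N then M (rep u.1) b v.2 u.2 else 0.
(* The invariant: after reading the expansion of [m], the forward vector is supported on the class
   of [m] and holds the values [g s m]. *)
pose vec m (u : Q * S) : R := if u.1 == q m then g u.2 m else 0.
pose final (u : Q * S) : R := (u.2 == s0)%:R.
exists (WAutomaton (vec 0%N) trans final) => n; rewrite weight_foldl.
have pick m (F : Q -> S -> R) :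
    \sum_u vec m u * F u.1 u.2 = \sum_t g t m * F (q m) t.
  rewrite -(pair_bigA _ (fun x s => vec m (x, s) * F x s)) /=.
  rewrite (bigD1 (q m)) //= [X in _ + X]big1 ?addr0 => [|x /negbTE hx]; last first.
    by apply: big1 => s _; rewrite /vec /= hx mul0r.
  by apply: eq_bigr => s _; rewrite /vec /= eqxx.
have vecS m b u : wstep trans (vec m) b u = vec (zphi m + b)%N u.
  rewrite /wstep (pick m (fun x s => trans (x, s) b u)) /trans /=.
  rewrite (hq _ m) ?repK // /vec; case: eqP => _; last first.
    by apply: big1 => s _; rewrite mulr0.
  by rewrite hg; apply: eq_bigr => s _; rewrite mulrC (hM _ m).
have run w : zcanonical w ->
    forall u, foldl (wstep trans) (vec 0%N) w u = vec (zval 0 w) u.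
  elim/last_ind: w => [|w b IH] hw u; first by rewrite /= zval_nil.
  have [/IH {}IH _ _] := zcanonical_rconsE hw.
  have [hc _ _] := zcanonical_rconsE hw.
  rewrite foldl_rcons zval_rcons muln1 -zphi_canonical // -vecS.
  by apply: eq_bigr => t _; rewrite IH.
transitivity (\sum_u vec n u * final u).
  rewrite (pick n (fun _ s => (s == s0)%:R)) (bigD1 s0) //= eqxx mulr1.
  by rewrite big1 ?addr0 // => s /negbTE->; rewrite mulr0.
by apply: eq_bigr => u _; rewrite run ?zeck_canonical // zeckK.
Qed.

(** * The Mahler equation in window coordinates *)

Lemma pseries_mulE (p : {poly R}) J h n :
  (size p <= J)%N ->
  pseries_mul p h n = \sum_(j < J | (j <= n)%N) p`_j * h (n - j)%N.
Proof.
move=> hJ; rewrite /pseries_mul.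
have F i : (J <= i)%N -> p`_i * h (n - i)%N = 0.
  by move=> hi; rewrite nth_default ?mul0r // (leq_trans hJ).
rewrite -(big_mkord (fun j => j <= n)%N (fun j => p`_j * h (n - j)%N)).
rewrite -(big_mkord xpredT (fun j => p`_j * h (n - j)%N)).
rewrite (big_nat_widen 0 n.+1 (maxn J n.+1)) ?leq_maxr //=.
rewrite (big_nat_widen 0 J (maxn J n.+1)) ?leq_maxl //=.
rewrite [LHS](bigID (fun i => i < J)%N) /= [X in _ + X]big1 ?addr0 => [|i]; last first.
  by rewrite -leqNgt => /andP[_ /F].
by apply: eq_bigl => i; rewrite ltnS.
Qed.

Section Window.
Variable C : nat.

(** The series is extended by zero to negative indices; [c = C] is the centre of the window. *)
Definition zshift (h : nat -> R) (c m : nat) : R :=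
  if (C <= m + c)%N then h (m + c - C)%N else 0.

(** At most one term survives, since phi is injective: the one where [m + c' - C] is the preimage of
    the point, which [zmove_ex] keeps inside the window. *)
Lemma zshift_zPhi (h : nat -> R) m (b : bool) c j :
  (2 * j + 3 <= C)%N -> (c <= 2 * C)%N ->
  (if (C + j <= zphi m + b + c)%N then zPhi h (zphi m + b + c - C - j)%N else 0)
  = \sum_(c' < (2 * C).+1) (zmove C m b c j c')%:R * zshift h c' m.
Proof.
move=> hj hc.
have none : (forall k, zphi k + C + j != zphi m + b + c)%N ->
    \sum_(c' < (2 * C).+1) (zmove C m b c j c')%:R * zshift h c' m = 0.
  move=> hk; apply: big1 => c' _; rewrite /zmove eq_sym (negbTE (hk _)) andbF.
  by rewrite mul0r.
case: leqP => hp; last first.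
  by rewrite none // => k; apply/eqP; lia.
case: (boolP (zlast (zphi m + b + c - C - j))) => hl.
  have hout k : zphi k <> (zphi m + b + c - C - j)%N.
    by move=> e; move: hl; rewrite -e zlast_zphi.
  by rewrite zPhi_out // none // => k; apply/eqP => e; apply: (hout k); lia.
have [k hk] := zlast_imageP _ hl.
have e : (zphi m + b + c = zphi k + C + j)%N by lia.
have [h1 h2] := zmove_ex hj hc e.
have hc' : (k + C - m < (2 * C).+1)%N by lia.
rewrite -hk zPhi_zphi (bigD1 (Ordinal hc')) //= big1 ?addr0 => [|c' hne].
  rewrite /zmove /zshift.
  have -> : (m + (k + C - m) = k + C)%N by lia.
  by rewrite leq_addl addnK e eqxx mul1r.
rewrite /zmove; case: andP => [[h3 /eqP]|_]; last by rewrite mul0r.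
rewrite e => /addIn /addIn /zphi_inj h4; case/eqP: hne.
by apply: val_inj => /=; lia.
Qed.

End Window.
End Automaton.

Theorem theorem1 (R : comNzRingType) (d : nat) (A : nat -> {poly R})
    (f : nat -> R) (hf : forall n : nat, isolating_zmahler d A f n = 0) :
  exists Aut : wautomaton R bool, zgenerates Aut f.
Proof.
pose J := (\max_(k < d) size (A k.+1))%N.
have hJ (k : 'I_d) : (size (A k.+1) <= J)%N.
  exact: (leq_bigmax (F := fun k : 'I_d => size (A k.+1))).
(* C is large enough for the window of m to contain every k with
   phi(k) = phi(m) + b + c - j, where |c| <= C and j < J. *)
pose C := (2 * J + 3)%N.
pose S : finType := ('I_d.+1 * 'I_(2 * C).+1)%type.
pose g (s : S) := zshift C (iter s.1 (@zPhi R) f) s.2.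
(* A positive index just undoes one Phi. Index 0 first expands [f] by the equation, and each
   resulting Phi^(k+1) then drops to Phi^k with k < d. *)
pose M m b (s t : S) : R :=
  if s.1 : nat is k.+1 then (t.1 == k :> nat)%:R * (zmove C m b s.2 0 t.2)%:R
  else if (t.1 < d)%N then
    \sum_(j < J) (A t.1.+1)`_j * (zmove C m b s.2 j t.2)%:R
  else 0.
have C2 : (2 < C)%N by rewrite /C; lia.
have hC : (C < (2 * C).+1)%N by lia.
have hM m m' b s t : zwindow C m = zwindow C m' -> M m b s t = M m' b s t.
  have ht : (t.2 <= 2 * C)%N by rewrite -ltnS.
  move=> e; rewrite /M (zmove_window _ _ _ ht e).
  case: (nat_of_ord s.1) => [|//]; case: ifP => // _.
  by apply: eq_bigr => j _; rewrite (zmove_window _ _ _ ht e).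
have hg m (b : bool) s : g s (zphi m + b)%N = \sum_t M m b s t * g t m.
  case: s => i c; have hc : (c <= 2 * C)%N by rewrite -ltnS.
  rewrite -(pair_bigA _ (fun i' c' => M m b (i, c) (i', c') * g (i', c') m)) /=.
  rewrite /g /M /=; case: i => -[|k] hk /=.
    rewrite big_ord_recr /= ltnn [X in _ + X]big1 ?addr0 => [|c' _]; last first.
      by rewrite mul0r.
    transitivity (\sum_(k < d) \sum_(j < J) (A k.+1)`_j *
        (if (C + j <= zphi m + b + c)%N
         then iter k.+1 (@zPhi R) f (zphi m + b + c - C - j)%N else 0)).
      rewrite /zshift; case: leqP => hp; last first.
        rewrite big1 // => k _; rewrite big1 // => j _.
        (* A point at a negative index stays negative when lowered by [j]. *)
        by rewrite ifN ?mulr0 // -ltnNge; lia.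
      move/eqP: (hf (zphi m + b + c - C)%N); rewrite subr_eq0 => /eqP->.
      rewrite big_add1 big_mkord; apply: eq_bigr => k _.
      rewrite (pseries_mulE _ _ (hJ k)) big_mkcond; apply: eq_bigr => j _.
      by rewrite leq_subRL //; case: ifP => // _; rewrite mulr0.
    apply: eq_bigr => k _; rewrite ltn_ord.
    under [RHS]eq_bigr => c' _ do rewrite mulr_suml.
    rewrite exchange_big; apply: eq_bigr => j _.
    rewrite zshift_zPhi //; last by rewrite /C; have := ltn_ord j; lia.
    by rewrite mulr_sumr; apply: eq_bigr => c' _; rewrite mulrA.
  have hk' : (k < d.+1)%N by lia.
  rewrite (bigD1 (Ordinal hk')) //= [X in _ + X]big1 ?addr0 => [|i' hi']; last first.
    apply: big1 => c' _; have /negbTE-> : i' != k :> nat by [].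
    by rewrite !mul0r.
  under [RHS]eq_bigr => c' _ do rewrite eqxx mul1r.
  by rewrite -zshift_zPhi // ?addn0 ?subn0 // /C; lia.
(* The index (0, C) stands for [f] at [m] itself. *)
have [Aut hAut] := zgenerates_recursion (ord0, Ordinal hC)
  (fun m m' b => @zwindow_step C m m' b C2) hM hg.
by exists Aut => n; rewrite -hAut /g /zshift /= leq_addl addnK.
Qed.
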